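(* Let $N$, $l$ and $m$ be positive integers such that $l\le N-1$, $N\neq 2l$ and $1\le m\le N$. Let $B_1,\ldots,B_N$ be independent identically distributed random variables with $\mathrm{Prob}(B_n=1)=\frac{m}{N}$ and $\mathrm{Prob}(B_n=0)=1-\frac{m}{N}$, and let $$\widetilde{X}_l(m,N)=\sum_{n=1}^N\exp\left(-\frac{2jnl\pi}{N}\right)B_n=\widetilde{U}_l(m,N)+j\widetilde{V}_l(m,N),$$ where $j$ is the imaginary unit and $\widetilde{U}_l(m,N)$, $\widetilde{V}_l(m,N)$ are the real and imaginary parts of $\widetilde{X}_l(m,N)$. Then for each real number $t\ge 0$: (i) $\mathrm{Prob}\left(|\widetilde{U}_l(m,N)|\ge t\right)\le 2\exp\left(-\frac{4t^2}{N}\right)$; (ii) $\mathrm{Prob}\left(|\widetilde{V}_l(m,N)|\ge t\right)\le 2\exp\left(-\frac{4t^2}{N}\right)$; (iii) $\mathrm{Prob}\left(\left||\widetilde{X}_l(m,N)|-\mathbb{E}[|\widetilde{X}_l(m,N)|]\right|\ge t\right)\le 2\exp\left(-\frac{2t^2}{N}\right)$.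
   Context: Here $j$ denotes the imaginary unit ($j^2=-1$). Explicitly, $\widetilde{U}_l(m,N)=\sum_{n=1}^N\cos\left(\frac{2nl\pi}{N}\right)B_n$ and $\widetilde{V}_l(m,N)=-\sum_{n=1}^N\sin\left(\frac{2nl\pi}{N}\right)B_n$. *)

(* Defs.v *)
From HB Require Import structures.
From mathcomp Require Import all_boot all_order all_algebra.
From mathcomp Require Import all_classical all_reals all_analysis.
From mathcomp Require Import complex.
Import Order.TTheory GRing.Theory Num.Theory.
Import numFieldNormedType.Exports.

Set Implicit Arguments.
Unset Strict Implicit.
Unset Printing Implicit Defensive.

Local Open Scope classical_set_scope.
Local Open Scope ring_scope.
Local Open Scope complex_scope.

Definition mutually_independent (d : measure_display) (T : measurableType d)
    (R : realType) (P : probability T R) (I : finType)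
    (X : I -> {RV P >-> R}) : Prop :=
  forall (J : {set I}) (A : I -> set R),
    (forall i, measurable (A i)) ->
    P [set w | forall i, i \in J -> A i (X i w)] =
    (\prod_(i in J) P [set w | A i (X i w)])%E.

Definition identically_distributed (d : measure_display)
    (T : measurableType d) (R : realType) (P : probability T R) (I : finType)
    (X : I -> {RV P >-> R}) : Prop :=
  forall (i j : I) (A : set R), measurable A ->
    distribution P (X i) A = distribution P (X j) A.

Definition cexp (R : realType) (z : R[i]) : R[i] :=
  let: x +i* y := z in (expR x * cos y) +i* (expR x * sin y).

(* The family is indexed from 0: [B k] is the variable $B_{k+1}$, whence the
   [k.+1] in the exponent. *)
Definition Xtilde (R : realType) (N : nat) (T : Type) (B : 'I_N -> T -> R)
    (l : nat) (w : T) : R[i] :=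
  \sum_(k < N)
    cexp (- (2 * 'i%C * (k.+1)%:R * l%:R * pi%:C / N%:R)) * (B k w)%:C.

Definition Utilde (R : realType) (N : nat) (T : Type) (B : 'I_N -> T -> R)
    (l : nat) (w : T) : R := complex.Re (Xtilde B l w).

Definition Vtilde (R : realType) (N : nat) (T : Type) (B : 'I_N -> T -> R)
    (l : nat) (w : T) : R := complex.Im (Xtilde B l w).

Definition absX (R : realType) (N : nat) (T : Type) (B : 'I_N -> T -> R)
    (l : nat) (w : T) : R := ComplexField.Normc.normc (Xtilde B l w).

(* Main.v *)
(* All three bounds are instances of McDiarmid's inequality
     Prob(|f - E f| >= t) <= 2 exp(- 2 t^2 / sum_k c_k^2)
   for a function f of independent Bernoulli variables that varies by at most
   c_k with its k-th argument.  For the real and imaginary parts, c_k is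
   |cos (2 pi k l / N)|, resp. |sin (2 pi k l / N)|: the mean vanishes because N
   does not divide l, and the squares sum to N / 2 because N does not divide
   2 l.  For the modulus, the triangle inequality gives c_k = 1.  McDiarmid's
   inequality follows from Chernoff's method, by conditioning on one variable at
   a time and applying Hoeffding's lemma to it. *)
Require Import Defs.
From HB Require Import structures.
From mathcomp Require Import all_boot all_order all_algebra.
From mathcomp Require Import all_classical all_reals all_analysis.
From mathcomp Require Import complex.
From mathcomp Require Import measurable_realfun ring lra.
Import Order.TTheory GRing.Theory Num.Theory.
Import numFieldNormedType.Exports.

Local Open Scope classical_set_scope.
Local Open Scope ring_scope.

Set Implicit Arguments.
Unset Strict Implicit.
Unset Printing Implicit Defensive.

(** * Hoeffding's lemma for a Bernoulli variable *)

Lemma ger0_is_derive_ndecr (R : realType) (f df : R -> R) (a : R) :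
  (forall x : R, is_derive x (1 : R) f (df x)) ->
  (forall x, a <= x -> 0 <= df x) ->
  forall x, a <= x -> f a <= f x.
Proof.
move=> fd df0 x ax.
have fD y : derivable f y 1 by have [] := fd y.
apply: (@ger0_derive1_ndecry R f a) => // [y|].
  rewrite in_itv/= andbT => ay; rewrite derive1E derive_val; exact/df0/ltW.
apply: continuous_subspaceT => y.
exact/differentiable_continuous/derivable1_diffP.
Qed.

(** The logarithm of the quotient of the right side by the left side vanishes at 0 together with its
    derivative, and its second derivative is nonnegative on the half-line. *)
Lemma bernoulli_mgf_le (R : realType) (p u : R) : 0 <= p <= 1 ->
  (1 - p) * expR (- (p * u)) + p * expR ((1 - p) * u) <= expR (u ^+ 2 / 8).
Proof.
(* Swapping [p, u] with [1 - p, - u] reduces to [0 <= u]. *)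
wlog u0 : p u / 0 <= u => [hw p01|/andP[p0 p1]].
  have [|un] := leP 0 u; first by move=> u0; exact: hw.
  have := hw (1 - p) (- u).
  rewrite oppr_ge0 ltW// => /(_ isT).
  have -> : 0 <= 1 - p <= 1 by lra.
  move=> /(_ isT); rewrite sqrrN addrC => h; apply: le_trans h.
  by rewrite subKr !mulrN opprK.
(* Factoring [expR (- (p * u))] out of the left side leaves [D u]. *)
pose D (x : R) := 1 - p + p * expR x.
have D0 x : 0 < D x.
  rewrite /D; have [->|p_neq1] := eqVneq p 1.
    by rewrite subrr add0r mul1r expR_gt0.
  by rewrite ltr_pwDl ?mulr_ge0 ?expR_ge0// subr_gt0 lt_neqAle p_neq1.
have dD x : is_derive x (1 : R) D (p * expR x).
  by apply: is_derive_eq; rewrite ?scaler0 /GRing.scale/=; ring.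
(* [psi] is the derivative of [phi], the logarithm of the quotient of the two
   sides. *)
pose psi (x : R) := p + x / 4 - 1 + (1 - p) * (D x)^-1.
have dpsi x : is_derive x (1 : R) psi (1 / 4 - (1 - p) * p * expR x / D x ^+ 2).
  have := D0 x; rewrite lt0r => /andP[Dx _].
  have dV : is_derive x (1 : R) (fun y => (D y)^-1)
      (- (D x) ^- 2 *: (p * expR x)).
    exact: is_deriveV.
  by apply: is_derive_eq; rewrite /GRing.scale/=; field.
have psi_ge0 x : 0 <= x -> 0 <= psi x.
  move=> x0; have <- : psi 0 = 0 by rewrite /psi /D expR0; field; lra.
  apply: (@ger0_is_derive_ndecr R psi _ 0 dpsi) => // y _.
  rewrite subr_ge0 ler_pdivrMr ?exprn_gt0// /D -subr_ge0.
  set e := expR y.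
  (* AM-GM for [1 - p] and [p * e], whose sum is [D y]: the gap is a quarter of a square. *)
  have -> : 1 / 4 * (1 - p + p * e) ^+ 2 - (1 - p) * p * e
          = 1 / 4 * (1 - p - p * e) ^+ 2 by field.
  by rewrite mulr_ge0// sqr_ge0.
pose phi (x : R) := p * x + x ^+ 2 / 8 - ln (D x).
have dphi x : is_derive x (1 : R) phi (psi x).
  have := D0 x; rewrite lt0r => /andP[Dx _].
  have dl : is_derive x (1 : R) (@ln R \o D) ((D x)^-1 * (p * expR x)).
    by apply: is_derive1_comp; apply: is_derive1_ln.
  rewrite /phi; apply: is_derive_eq.
  rewrite /psi /GRing.scale/=; move: Dx; rewrite /D => Dx; field; exact: Dx.
have : phi 0 <= phi u by exact: (@ger0_is_derive_ndecr R phi _ 0 dphi).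
rewrite {1}/phi /D expR0 mulr1 subrK ln1 mulr0 expr0n/= mul0r addr0 subrr.
rewrite /phi subr_ge0 -ler_expR lnK ?posrE// => h.
rewrite -(ler_pM2l (expR_gt0 (p * u))) -expRD (le_trans _ h)//.
rewrite mulrDr !(mulrCA (expR (p * u))) -!expRD addrN expR0 mulr1 /D.
by rewrite (_ : p * u + (1 - p) * u = u)//; ring.
Qed.

(** * Expectations over independent Bernoulli bits, as finite sums *)

Definition bernoulli_weight (R : pzRingType) (p : R) (x : bool) : R :=
  if x then p else 1 - p.

(** With [f] on plain sequences, [fun b => f (x :: b)] has the same type, so that inductions on [n]
    can fix the first bit. *)
Definition bernoulli_mean (R : pzRingType) (p : R) (n : nat)
    (f : seq bool -> R) : R :=
  \sum_(b : n.-tuple bool) (\prod_(x <- b) bernoulli_weight p x) * f b.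

Lemma bernoulli_mean0 (R : pzRingType) (p : R) (f : seq bool -> R) :
  bernoulli_mean p 0 f = f [::].
Proof.
rewrite /bernoulli_mean (big_pred1 [tuple]) => [|b]; last first.
  by rewrite (tuple0 b) /= eqxx.
by rewrite big_nil mul1r.
Qed.

(** A tuple is a head and a tail, and the weights multiply: this is conditioning on the first
    bit. *)
Lemma bernoulli_meanS (R : pzRingType) (p : R) (n : nat) (f : seq bool -> R) :
  bernoulli_mean p n.+1 f =
    (1 - p) * bernoulli_mean p n (fun b => f (false :: b)) +
    p * bernoulli_mean p n (fun b => f (true :: b)).
Proof.
rewrite /bernoulli_mean.
rewrite (reindex (fun xb : bool * n.-tuple bool =>
  [tuple of xb.1 :: xb.2])) /=; last first.
  exists (fun b => (thead b, [tuple of behead b])) => [[x b] _|b _] /=.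
    by congr (_, _); exact: val_inj.
  by rewrite [RHS]tuple_eta.
rewrite -(pair_bigA _ (fun x (b : n.-tuple bool) =>
  (\prod_(y <- x :: b) bernoulli_weight p y) * f (x :: b))) /=.
rewrite big_bool addrC; congr (_ + _); rewrite mulr_sumr;
  by apply: eq_bigr => b _; rewrite big_cons mulrA.
Qed.

Lemma bernoulli_mean_cst (R : pzRingType) (p c : R) (n : nat) :
  bernoulli_mean p n (fun=> c) = c.
Proof.
elim: n => [|n IHn]; first exact: bernoulli_mean0.
by rewrite bernoulli_meanS !IHn -mulrDl subrK mul1r.
Qed.

Lemma bernoulli_meanD (R : pzRingType) (p : R) (n : nat) (f g : seq bool -> R) :
  bernoulli_mean p n (fun b => f b + g b) =
  bernoulli_mean p n f + bernoulli_mean p n g.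
Proof.
by rewrite /bernoulli_mean -big_split; apply: eq_bigr => b _; rewrite mulrDr.
Qed.

Lemma bernoulli_meanZ (R : comPzRingType) (p c : R) (n : nat)
    (f : seq bool -> R) :
  bernoulli_mean p n (fun b => c * f b) = c * bernoulli_mean p n f.
Proof.
by rewrite /bernoulli_mean mulr_sumr; apply: eq_bigr => b _; rewrite mulrCA.
Qed.

Lemma ler_bernoulli_mean (R : numDomainType) (p : R) (n : nat)
    (f g : seq bool -> R) : 0 <= p <= 1 ->
  (forall b, size b = n -> f b <= g b) ->
  bernoulli_mean p n f <= bernoulli_mean p n g.
Proof.
move=> /andP[p0 p1] fg; apply: ler_sum => b _.
rewrite ler_wpM2l ?fg ?size_tuple// prodr_ge0// => -[] _ //=.
by rewrite subr_ge0.
Qed.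

(** Linearity, each bit having mean [p]; the means of the real and imaginary parts vanish through it
    once their coefficients sum to 0. *)
Lemma bernoulli_mean_linear (R : comPzRingType) (p : R) (n : nat)
    (c : nat -> R) :
  bernoulli_mean p n (fun b => \sum_(k < n) c k * (nth false b k)%:R) =
  p * \sum_(k < n) c k.
Proof.
elim: n c => [|n IHn] c; first by rewrite bernoulli_mean0 !big_ord0 mulr0.
rewrite bernoulli_meanS.
have E x : bernoulli_mean p n
    (fun b => \sum_(k < n.+1) c k * (nth false (x :: b) k)%:R) =
    c 0%N * x%:R + p * \sum_(k < n) c k.+1.
  rewrite -(IHn (c \o S)) -[X in _ = X + _](bernoulli_mean_cst p _ n).
  rewrite -bernoulli_meanD.
  by apply: eq_bigr => b _; rewrite big_ord_recl.
by rewrite !E big_ord_recl /=; ring.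
Qed.

(** * McDiarmid's inequality for independent bits *)

(** The flipped bit has index [size b1]. Splitting the string around it lets the condition pass to
    tails by lengthening [b1]. *)
Definition bounded_differences (R : numDomainType) (n : nat) (c : nat -> R)
    (f : seq bool -> R) : Prop :=
  forall b1 b2 : seq bool, (size b1 + size b2).+1 = n ->
    `|f (b1 ++ true :: b2) - f (b1 ++ false :: b2)| <= c (size b1).

(* Condition on the first coordinate and apply Hoeffding's lemma to it. *)
Lemma mcdiarmid_mgf (R : realType) (p : R) (n : nat) (c : nat -> R)
    (f : seq bool -> R) (s : R) : 0 <= p <= 1 -> bounded_differences n c f ->
  bernoulli_mean p n (fun b => expR (s * (f b - bernoulli_mean p n f))) <=
  expR (s ^+ 2 * (\sum_(k < n) c k ^+ 2) / 8).
Proof.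
move=> p01; elim: n c f => [|n IHn] c f fc.
  by rewrite !bernoulli_mean0 subrr mulr0 big_ord0 mulr0 mul0r.
(* [g x] is the conditional mean of [f] given that the first bit is [x]. *)
pose g x := bernoulli_mean p n (fun b => f (x :: b)).
(* The deviation of [f] is that of [f (x :: b)] from [g x], handled by induction, plus a term that
   depends on [x] only. *)
have gE x : bernoulli_mean p n
      (fun b => expR (s * (f (x :: b) - bernoulli_mean p n.+1 f))) <=
    expR (s * (g x - bernoulli_mean p n.+1 f)) *
      expR (s ^+ 2 * (\sum_(k < n) c k.+1 ^+ 2) / 8).
  have fxc : bounded_differences n (c \o S) (fun b => f (x :: b)).
    by move=> b1 b2 b12; apply: (fc (x :: b1) b2); rewrite -b12.
  apply: le_trans (ler_wpM2l (expR_ge0 _) (IHn _ _ fxc)).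
  rewrite -bernoulli_meanZ; apply: ler_bernoulli_mean => // b _.
  by rewrite -expRD -mulrDr le_eqVlt [_ - _ + _]addrC subrKA eqxx.
(* Both conditional means average over the same tail, so the pointwise bound for flipping the first
   bit survives. *)
have gd : `|g true - g false| <= c 0%N.
  rewrite ler_norml lerBrDr lerBlDr -[c 0%N](bernoulli_mean_cst p _ n).
  rewrite -mulN1r -bernoulli_meanZ -!bernoulli_meanD.
  apply/andP; split; apply: ler_bernoulli_mean => // b bn;
    have := fc [::] b; rewrite /= add0n bn => /(_ erefl);
    by rewrite ler_norml => /andP[]; lra.
rewrite bernoulli_meanS big_ord_recl mulrDr mulrDl expRD.
set S := expR (_ * (\sum_(_ < _) _) / 8).
have [p0 p1] := andP p01.
apply: (@le_trans _ _
   ((1 - p) * (expR (s * (g false - bernoulli_mean p n.+1 f)) * S) +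
    p * (expR (s * (g true - bernoulli_mean p n.+1 f)) * S))).
  by apply: lerD; rewrite ler_wpM2l ?subr_ge0.
rewrite !mulrA -mulrDl ler_wpM2r ?expR_ge0// bernoulli_meanS -!/(g _).
(* The overall mean is [(1 - p) * g false + p * g true], so the two deviations are [- p] and [1 - p]
   times [g true - g false]. *)
have := @bernoulli_mgf_le _ p (s * (g true - g false)) p01.
set L := (X in X <= _ -> _); set L' := (X in _ -> X <= _).
have -> : L = L'.
  by rewrite /L /L'; congr (_ * expR _ + _ * expR _); ring.
move=> /le_trans; apply; rewrite ler_expR ler_wpM2r//.
rewrite exprMn -mulrA -expr2 ler_wpM2l ?sqr_ge0//.
by rewrite -(real_normK (num_real _)) lerXn2r ?nnegrE// (le_trans _ gd).
Qed.

(* Chernoff's bound; [s := 4 t / V] minimises [s ^+ 2 * V / 8 - s * t]. *)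
Lemma mcdiarmid (R : realType) (p : R) (n : nat) (c : nat -> R)
    (f : seq bool -> R) (t : R) : 0 <= p <= 1 -> bounded_differences n c f ->
  0 < \sum_(k < n) c k ^+ 2 -> 0 <= t ->
  bernoulli_mean p n (fun b => (t <= `|f b - bernoulli_mean p n f|)%R%:R) <=
  2 * expR (- (2 * t ^+ 2 / \sum_(k < n) c k ^+ 2)).
Proof.
move=> p01 fc; set V := \sum_(k < n) _ => V0 t0.
set m := bernoulli_mean p n f; pose s := 4 * t / V.
have s0 : 0 <= s by rewrite divr_ge0 ?mulr_ge0// ltW.
(* Both tails at once: whatever the sign of [f b - m], one of the two exponentials dominates the
   indicator. *)
apply: (@le_trans _ _ (bernoulli_mean p n (fun b => expR (- (s * t)) *
    (expR (s * (f b - m)) + expR (- s * (f b - m)))))).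
  apply: ler_bernoulli_mean => // b _.
  have [tle|_] := leP t `|f b - m|; last first.
    by rewrite /= mulr_ge0 ?addr_ge0 ?expR_ge0.
  rewrite [true%:R]/= mulrDr -!expRD.
  have [fm0|fm0] := leP 0 (f b - m).
    rewrite ler_wpDr ?expR_ge0// -expR0 ler_expR addrC subr_ge0 ler_wpM2l//.
    by move: tle; rewrite ger0_norm.
  rewrite ler_wpDl ?expR_ge0// -expR0 ler_expR mulNr -mulrN addrC.
  rewrite subr_ge0 ler_wpM2l//.
  by move: tle; rewrite ltr0_norm.
rewrite bernoulli_meanZ bernoulli_meanD.
have h1 := @mcdiarmid_mgf _ _ _ _ _ s p01 fc.
(* Only [s ^+ 2] enters the bound, so [- s] gives the same one, whence the factor 2. *)
have := @mcdiarmid_mgf _ _ _ _ _ (- s) p01 fc; rewrite sqrrN => h2.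
apply: le_trans (ler_wpM2l (expR_ge0 _) (lerD h1 h2)) _.
rewrite -mulr2n mulrnAr -expRD mulr_natl.
rewrite lerMn2r /= ler_expR -/V le_eqVlt; apply/orP; left; apply/eqP.
by rewrite /s; field; rewrite gt_eqF.
Qed.

(** * Trigonometric sums over full periods *)

(** [2 * sin x * cos (2 * k * x)] is [sin ((2 * k + 1) * x) - sin ((2 * k - 1) * x)], which
    telescopes. *)
Lemma sum_cos_telescope (R : realType) (x : R) (n : nat) :
  2 * sin x * (\sum_(k < n) cos (k.+1%:R * (2 * x))) =
  sin ((2 * n%:R + 1) * x) - sin x.
Proof.
elim: n => [|n IHn]; first by rewrite big_ord0 !mulr0 add0r mul1r subrr.
rewrite big_ord_recr mulrDr {}IHn /= -[n.+1%:R]natr1.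
rewrite (_ : (2 * n%:R + 1) * x = (n%:R + 1) * (2 * x) - x); last by ring.
rewrite (_ : (2 * (n%:R + 1) + 1) * x = (n%:R + 1) * (2 * x) + x); last by ring.
by rewrite sinB sinD; ring.
Qed.

Lemma sum_sin_telescope (R : realType) (x : R) (n : nat) :
  2 * sin x * (\sum_(k < n) sin (k.+1%:R * (2 * x))) =
  cos x - cos ((2 * n%:R + 1) * x).
Proof.
elim: n => [|n IHn]; first by rewrite big_ord0 !mulr0 add0r mul1r subrr.
rewrite big_ord_recr mulrDr {}IHn /= -[n.+1%:R]natr1.
rewrite (_ : (2 * n%:R + 1) * x = (n%:R + 1) * (2 * x) - x); last by ring.
rewrite (_ : (2 * (n%:R + 1) + 1) * x = (n%:R + 1) * (2 * x) + x); last by ring.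
by rewrite cosB cosD; ring.
Qed.

(** At [x = pi * a / N] the last angle [(2 * N + 1) * x] is [x] plus [a] full turns, so the
    telescoped difference is 0; then [sin x] is cancelled. *)
Lemma sum_cos_full_period (R : realType) (N a : nat) : (0 < N)%N ->
  sin (pi * a%:R / N%:R) != 0 :> R ->
  \sum_(k < N) cos (k.+1%:R * (2 * (pi * a%:R / N%:R))) = 0 :> R.
Proof.
move=> N0 s0; have := sum_cos_telescope (pi * a%:R / N%:R : R) N.
have -> : (2 * N%:R + 1) * (pi * a%:R / N%:R) =
    pi * a%:R / N%:R + (pi *+ 2) *+ a :> R.
  by rewrite -[pi *+ 2 *+ a]mulr_natl; field; rewrite pnatr_eq0 -lt0n.
rewrite (periodicn (@sinD2pi R)) subrr => /eqP.
by rewrite !mulf_eq0 (negbTE s0) pnatr_eq0 => /eqP.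
Qed.

Lemma sum_sin_full_period (R : realType) (N a : nat) : (0 < N)%N ->
  sin (pi * a%:R / N%:R) != 0 :> R ->
  \sum_(k < N) sin (k.+1%:R * (2 * (pi * a%:R / N%:R))) = 0 :> R.
Proof.
move=> N0 s0; have := sum_sin_telescope (pi * a%:R / N%:R : R) N.
have -> : (2 * N%:R + 1) * (pi * a%:R / N%:R) =
    pi * a%:R / N%:R + (pi *+ 2) *+ a :> R.
  by rewrite -[pi *+ 2 *+ a]mulr_natl; field; rewrite pnatr_eq0 -lt0n.
rewrite (periodicn (@cosD2pi R)) subrr => /eqP.
by rewrite !mulf_eq0 (negbTE s0) pnatr_eq0 => /eqP.
Qed.

(** The angle lies strictly between 0 and [pi], or between [pi] and [2 * pi]. The second range
    serves [a = 2 * l] with [l] above [N / 2]. *)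
Lemma sin_pi_frac_neq0 (R : realType) (N a : nat) :
  (0 < a < N)%N || (N < a < 2 * N)%N -> sin (pi * a%:R / N%:R) != 0 :> R.
Proof.
case/orP => /andP[a1 a2].
  have N0 : (0 : R) < N%:R by rewrite ltr0n (leq_trans _ a2).
  have N0' : (0 < N)%N by rewrite -(ltr0n R).
  rewrite gt_eqF// sin_gt0_pi// divr_gt0 ?mulr_gt0 ?pi_gt0 ?ltr0n//=.
  by rewrite ltr_pdivrMr// ltr_pM2l ?pi_gt0// ltr_nat.
have N0 : (0 < N)%N.
  by have := leq_ltn_trans (leq0n a) a2; rewrite muln_gt0 => /andP[].
have N0' : (0 : R) < N%:R by rewrite ltr0n.
have -> : pi * a%:R / N%:R = pi * (a%:R - N%:R) / N%:R + pi :> R.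
  by field; rewrite gt_eqF.
rewrite (@sinDpi R) oppr_eq0 gt_eqF// sin_gt0_pi// -natrB; last exact: ltnW.
rewrite divr_gt0 ?mulr_gt0 ?pi_gt0 ?ltr0n ?subn_gt0//=.
rewrite ltr_pdivrMr// ltr_pM2l ?pi_gt0// ltr_nat.
by rewrite ltn_subLR ?(ltnW a1)// addnn -mul2n.
Qed.

(** As [cos x ^+ 2 = (1 + cos (2 * x)) / 2], what must vanish is the sum at frequency [2 * l], which
    lies strictly between 0 and [2 * N] and differs from [N]. *)
Lemma sum_cos2 (R : realType) (N l : nat) :
  (0 < l < N)%N -> N <> (2 * l)%N ->
  \sum_(k < N) cos (k.+1%:R * (2 * (pi * l%:R / N%:R))) ^+ 2 = N%:R / 2 :> R.
Proof.
move=> /andP[l0 lN] Nl; have N0 : (0 < N)%N by exact: leq_trans lN.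
have s2 : sin (pi * (2 * l)%:R / N%:R) != 0 :> R.
  apply: sin_pi_frac_neq0; rewrite muln_gt0 l0 ltn_pmul2l// lN andbT /=.
  by rewrite andbT orbC -neq_ltn; apply/eqP.
have cos2E (x : R) : cos x ^+ 2 = 1 / 2 + 1 / 2 * cos (2 * x).
  by rewrite mulr_natl cos_mulr2n; field.
under eq_bigr do rewrite cos2E.
rewrite big_split /= sumr_const card_ord -mulr_sumr.
rewrite (eq_bigr (fun k : 'I_N =>
  cos (k.+1%:R * (2 * (pi * (2 * l)%:R / N%:R))))).
  by rewrite sum_cos_full_period// mulr0 addr0 div1r -[LHS]mulr_natl.
by move=> k _; congr cos; rewrite natrM; ring.
Qed.

Lemma sum_sin2 (R : realType) (N l : nat) :
  (0 < l < N)%N -> N <> (2 * l)%N ->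
  \sum_(k < N) sin (k.+1%:R * (2 * (pi * l%:R / N%:R))) ^+ 2 = N%:R / 2 :> R.
Proof.
move=> lN Nl; under eq_bigr do rewrite sin2cos2.
by rewrite sumrB sum_cos2// sumr_const card_ord; field.
Qed.

(** * Reduction from the probability space to strings of bits *)

Section bernoulli_family.
Context (d : measure_display) (T : measurableType d) (R : realType).
Variables (P : probability T R) (N : nat) (B : 'I_N -> {RV P >-> R}) (p : R).
Hypothesis hind : mutually_independent B.
Hypothesis hB1 : forall n : 'I_N, P [set w | B n w = 1] = p%:E.
Hypothesis hB0 : forall n : 'I_N, P [set w | B n w = 0] = (1 - p)%:E.

Definition outcome_event (b : seq bool) : set T :=
  [set w | forall i : 'I_N, B i w = (nth false b i)%:R].

Lemma measurable_outcome_event (b : seq bool) : measurable (outcome_event b).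
Proof.
have -> : outcome_event b =
    \bigcap_(i in [set: 'I_N]) (B i @^-1` [set (nth false b i)%:R]).
  by apply/seteqP; split => w /= h i => [_|]; exact: h.
apply: fin_bigcap_measurable => [|i _]; first exact: finite_finset.
exact: measurable_funPTI.
Qed.

Lemma probability_outcome_event (b : N.-tuple bool) :
  P (outcome_event b) = (\prod_(x <- b) bernoulli_weight p x)%:E.
Proof.
have := @hind finset.setT (fun i => [set (nth false b i)%:R]).
move=> /(_ (fun=> measurable_set1 _)).
rewrite (_ : [set _ | _] = outcome_event b); last first.
  by apply/seteqP; split => w /= h i => [|_]; apply: h; rewrite ?finset.in_setT.
move=> ->; rewrite big_tuple -prodEFin.
apply: eq_big => [i|i _]; first by rewrite finset.in_setT.
rewrite (tnth_nth false) /bernoulli_weight.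
by case: (nth _ _ _) => /=; [exact: hB1|exact: hB0].
Qed.

Lemma trivIset_outcome_event (D : set (N.-tuple bool)) :
  trivIset D (fun b => outcome_event b).
Proof.
move=> b b' _ _ [w [bw b'w]]; apply: eq_from_tnth => i.
rewrite !(tnth_nth false); move: (bw i); rewrite (b'w i).
by case: (nth _ b i); case: (nth _ b' i) => // /eqP;
  rewrite /= ?oner_eq0 // eq_sym oner_eq0.
Qed.

(** The event that every variable is 0 or 1. The laws make it almost sure only, so its complement is
    treated as a null set. *)
Let outcomes : set T :=
  \big[setU/set0]_(b <- index_enum {: N.-tuple bool}) outcome_event b.

Let measurable_outcomes : measurable outcomes.
Proof. by apply: bigsetU_measurable => b _; exact: measurable_outcome_event. Qed.

Let integral_outcomes (h : T -> R) (f : seq bool -> R) :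
  measurable_fun setT h -> (forall w, 0 <= h w) ->
  (forall b w, size b = N -> outcome_event b w -> h w = f b) ->
  (\int[P]_(w in outcomes) (h w)%:E)%E = (bernoulli_mean p N f)%:E.
Proof.
move=> mh h0 hf; rewrite ge0_integral_bigsetU//; first last.
- by move=> w _; rewrite lee_fin.
- by apply/measurable_EFinP; exact: measurable_funTS.
- exact: trivIset_outcome_event.
- exact: index_enum_uniq.
- by move=> b; exact: measurable_outcome_event.
rewrite /bernoulli_mean -sumEFin; apply: eq_bigr => b _.
rewrite (eq_integral (cst (f b)%:E)) => [|w]; last first.
  by rewrite inE => bw /=; rewrite (hf b)// size_tuple.
rewrite integral_cst; last exact: measurable_outcome_event.
by rewrite muleC EFinM; congr (_ * _)%E; exact: probability_outcome_event.
Qed.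

Let probability_outcomes : P outcomes = 1%E.
Proof.
rewrite -[LHS]mul1e -integral_cst//.
by rewrite (@integral_outcomes (cst 1) (fun=> 1))// bernoulli_mean_cst.
Qed.

(** The complement of [outcomes] is null, so only the values of [h] on strings count. Nonnegativity
    lets the integral be split without an integrability argument. *)
Lemma expectation_bernoulli_family (h : T -> R) (f : seq bool -> R) :
  measurable_fun setT h -> (forall w, 0 <= h w) ->
  (forall b w, size b = N -> outcome_event b w -> h w = f b) ->
  ('E_P[h])%E = (bernoulli_mean p N f)%:E.
Proof.
move=> mh h0 hf; rewrite unlock -(setUv outcomes).
have mE : measurable_fun setT (EFin \o h) by exact/measurable_EFinP.
have PC0 : P (~` outcomes) = 0%E.
  by rewrite probability_setC// probability_outcomes subee.
rewrite ge0_integral_setU//=.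
- rewrite (@integral_outcomes h f)// null_set_integral ?adde0//.
  + exact: measurableC.
  + exact: measurable_funTS.
- exact: measurableC.
- by rewrite setUv.
- by move=> w _; rewrite lee_fin.
- exact/disj_setPCl.
Qed.

Lemma probability_bernoulli_family (Q : T -> bool) (q : seq bool -> bool) :
  measurable [set w | Q w] ->
  (forall b w, size b = N -> outcome_event b w -> Q w = q b) ->
  P [set w | Q w] = (bernoulli_mean p N (fun b => (q b)%:R))%:E.
Proof.
move=> mQ Qq; rewrite -expectation_indic//.
apply: expectation_bernoulli_family => [|w|b w bN bw].
- exact: measurable_indic.
- by rewrite indicE.
- rewrite indicE -(Qq b w bN bw); congr (nat_of_bool _)%:R.
  by apply/idP/idP; rewrite inE.
Qed.

End bernoulli_family.

(** * Sensitivity of linear forms and moduli to one bit *)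

Lemma sum_nth_flip (R : pzRingType) (n : nat) (a : nat -> R)
    (b1 b2 : seq bool) :
  (size b1 + size b2).+1 = n ->
  \sum_(k < n) a k * (nth false (b1 ++ true :: b2) k)%:R =
  \sum_(k < n) a k * (nth false (b1 ++ false :: b2) k)%:R + a (size b1).
Proof.
move=> b12; have b1n : (size b1 < n)%N by rewrite -b12 ltnS leq_addr.
rewrite (bigD1 (Ordinal b1n)) //= [in RHS](bigD1 (Ordinal b1n)) //=.
rewrite !nth_cat ltnn subnn /= mulr1 mulr0 add0r addrC; congr (_ + _).
apply: eq_bigr => k kb1; congr (_ * _%:R); rewrite !nth_cat.
case: ltnP => // b1k; have : (0 < k - size b1)%N.
  by rewrite subn_gt0 ltn_neqAle b1k andbT eq_sym.
by case: (k - size b1)%N.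
Qed.

Lemma bounded_differences_linear (R : numDomainType) (n : nat) (c : nat -> R) :
  bounded_differences n (fun k => `|c k|)
    (fun b => \sum_(k < n) c k * (nth false b k)%:R).
Proof. by move=> b1 b2 b12; rewrite (sum_nth_flip c b12) addrAC subrr add0r. Qed.

(** Flipping a bit adds [y = a (size b1)] to [z]; the triangle inequality for [z + y] and for
    [z = (z + y) - y] bounds both directions. *)
Lemma bounded_differences_normc (R : rcfType) (n : nat) (a : nat -> R[i]%C) :
  bounded_differences n (fun k => ComplexField.Normc.normc (a k))
    (fun b => ComplexField.Normc.normc (\sum_(k < n) a k * (nth false b k)%:R)).
Proof.
move=> b1 b2 b12; rewrite (sum_nth_flip a b12).
set z := \sum_(_ < _) _; set y := a _.
have h1 : ComplexField.Normc.normc (z + y) <=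
    ComplexField.Normc.normc z + ComplexField.Normc.normc y by exact: le_normcD.
have h2 : ComplexField.Normc.normc z <=
    ComplexField.Normc.normc (z + y) + ComplexField.Normc.normc y.
  rewrite -[leLHS](congr1 _ (addrK y z)) -[X in _ <= _ + X]normcN.
  exact: le_normcD.
by rewrite ler_norml; apply/andP; split; lra.
Qed.

(** * The transform through roots of unity *)

Section root_of_unity_sums.
Context (R : realType) (N l : nat).

(** The angle [2 * pi * (k + 1) * l / N], grouped as a multiple of [2 * x] to match the telescoping
    sums. *)
Let angle (k : nat) : R := k.+1%:R * (2 * (pi * l%:R / N%:R)).
Let root (k : nat) : R[i]%C := (cos (angle k) +i* (- sin (angle k)))%C.

Lemma cexp_angle (k : nat) :
  cexp (- (2 * 'i%C * (k.+1)%:R * l%:R * (pi : R)%:C%C / N%:R)) = root k.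
Proof.
have -> : - (2 * 'i%C * (k.+1)%:R * l%:R * (pi : R)%:C%C / N%:R) =
    (0 +i* (- angle k))%C.
  have -> : (0 +i* (- angle k))%C = - ((angle k)%:C%C * 'i%C).
    apply/eqP; rewrite eq_complex /= !(mul0r, mulr0, mulr1, addr0).
    by rewrite !(subrr, oppr0, subr0, add0r) !eqxx.
  by rewrite /angle !rmorphM /= fmorphV !rmorph_nat; ring.
by rewrite /cexp expR0 !mul1r cosN sinN.
Qed.

Lemma normc_root (k : nat) : ComplexField.Normc.normc (root k) = 1.
Proof. by rewrite /root /= sqrrN cos2Dsin2 sqrtr1. Qed.

Lemma XtildeE (T : Type) (B : 'I_N -> T -> R) (w : T) :
  Xtilde B l w = \sum_(k < N) root k * (B k w)%:C%C.
Proof. by apply: eq_bigr => k _; rewrite cexp_angle. Qed.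

Lemma UtildeE (T : Type) (B : 'I_N -> T -> R) (w : T) :
  Utilde B l w = \sum_(k < N) cos (angle k) * B k w.
Proof.
rewrite /Utilde XtildeE (big_morph (@complex.Re R) (id1 := 0) (op1 := +%R)) //.
  by apply: eq_bigr => k _ /=; rewrite mulr0 subr0.
by move=> [? ?] [? ?].
Qed.

Lemma VtildeE (T : Type) (B : 'I_N -> T -> R) (w : T) :
  Vtilde B l w = \sum_(k < N) - sin (angle k) * B k w.
Proof.
rewrite /Vtilde XtildeE (big_morph (@complex.Im R) (id1 := 0) (op1 := +%R)) //.
  by apply: eq_bigr => k _ /=; rewrite mulr0 add0r.
by move=> [? ?] [? ?].
Qed.

Lemma absXE (T : Type) (B : 'I_N -> T -> R) (w : T) :
  absX B l w = Num.sqrt (Utilde B l w ^+ 2 + Vtilde B l w ^+ 2).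
Proof. by rewrite /absX /Utilde /Vtilde; case: (Xtilde B l w). Qed.

Lemma absX_outcome (T : Type) (B : 'I_N -> T -> R) (w : T) (b : seq bool) :
  (forall k : 'I_N, B k w = (nth false b k)%:R) ->
  absX B l w =
    ComplexField.Normc.normc (\sum_(k < N) root k * (nth false b k)%:R).
Proof.
move=> Bb; rewrite /absX XtildeE; congr ComplexField.Normc.normc.
by apply: eq_bigr => k _; rewrite Bb rmorph_nat.
Qed.

End root_of_unity_sums.

(** * Tail bounds for the two parts and the modulus *)

Theorem theorem2p3 (R : realType) (d : measure_display) (T : measurableType d)
    (P : probability T R) (N l m : nat) (B : 'I_N -> {RV P >-> R})
    (hN : (0 < N)%N) (hl0 : (0 < l)%N) (hl : (l <= N - 1)%N)
    (hNl : N <> (2 * l)%N) (hm : (1 <= m <= N)%N)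
    (hind : mutually_independent B) (hid : identically_distributed B)
    (hB1 : forall n : 'I_N, P [set w | B n w = 1] = (m%:R / N%:R)%:E)
    (hB0 : forall n : 'I_N, P [set w | B n w = 0] = (1 - m%:R / N%:R)%:E)
    (t : R) (ht : 0 <= t) :
  [/\ (P [set w | (t <= `|Utilde B l w|)%R] <=
         (2 * expR (- (4 * t ^+ 2 / N%:R)))%:E)%E,
      (P [set w | (t <= `|Vtilde B l w|)%R] <=
         (2 * expR (- (4 * t ^+ 2 / N%:R)))%:E)%E
    & (P [set w | t%:E <= `|(absX B l w)%:E - 'E_P[absX B l]|] <=
         (2 * expR (- (2 * t ^+ 2 / N%:R)))%:E)%E ].
Proof.
have lN : (0 < l < N)%N by rewrite hl0 (leq_ltn_trans hl)// subn1 ltn_predL.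
have N0 : (0 : R) < N%:R by rewrite ltr0n.
have p01 : 0 <= (m%:R / N%:R : R) <= 1.
  by case/andP: hm => _ mN; rewrite divr_ge0// ler_pdivrMr// mul1r ler_nat.
have s0 : sin (pi * l%:R / N%:R) != 0 :> R by rewrite sin_pi_frac_neq0 ?lN.
have mlin (c : nat -> R) :
    measurable_fun setT (fun w => \sum_(k < N) c k * B k w).
  apply: measurable_sum => k.
  by apply: measurable_funM => //; exact: measurable_cst.
have measurable_tail (g : T -> R) : measurable_fun setT g ->
    measurable [set w | (t <= `|g w|)%R].
  move=> mg; rewrite -[X in measurable X]setTI.
  by apply: measurable_fun_le => //; exact: measurableT_comp.
(* Serves both parts: with mean 0 and squares summing to [N / 2], the exponent
   [2 * t ^+ 2 / (N / 2)] is [4 * t ^+ 2 / N]. *)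
have linear_tail (c : nat -> R) : \sum_(k < N) c k = 0 ->
    \sum_(k < N) c k ^+ 2 = N%:R / 2 ->
    (P [set w | (t <= `|\sum_(k < N) c k * B k w|)%R] <=
      (2 * expR (- (4 * t ^+ 2 / N%:R)))%:E)%E.
  move=> c0 c2.
  (* The subtracted 0 stands for the mean, to fit the form of [mcdiarmid]. *)
  rewrite (@probability_bernoulli_family _ _ _ _ _ B _ hind hB1 hB0
    (fun w => t <= `|\sum_(k < N) c k * B k w|)%R
    (fun b => t <= `|\sum_(k < N) c k * (nth false b k)%:R - 0|)%R); last 2 first.
  - exact: measurable_tail.
  - by move=> b w _ bw; rewrite subr0; under eq_bigr do rewrite bw.
  have := mcdiarmid p01 (@bounded_differences_linear _ N c) _ ht.
  under eq_bigr do rewrite real_normK ?num_real//.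
  rewrite c2 bernoulli_mean_linear c0 mulr0 divr_gt0// => /(_ isT).
  rewrite lee_fin => /le_trans; apply.
  rewrite (_ : 2 * t ^+ 2 / (N%:R / 2) = 4 * t ^+ 2 / N%:R)//.
  by field; rewrite gt_eqF.
pose angle k : R := k.+1%:R * (2 * (pi * l%:R / N%:R)).
split.
- rewrite (_ : [set w | _] = [set w | (t <= `|\sum_(k < N)
      cos (angle k) * B k w|)%R]); last first.
    by apply/seteqP; split => w /=; rewrite UtildeE.
  by apply: (linear_tail (fun k => cos (angle k)));
    rewrite ?sum_cos_full_period// sum_cos2.
- rewrite (_ : [set w | _] = [set w | (t <= `|\sum_(k < N)
      - sin (angle k) * B k w|)%R]); last first.
    by apply/seteqP; split => w /=; rewrite VtildeE.
  apply: (linear_tail (fun k => - sin (angle k))).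
    by rewrite sumrN sum_sin_full_period// oppr0.
  by under eq_bigr do rewrite sqrrN; rewrite sum_sin2.
have mU : measurable_fun setT (Utilde B l).
  rewrite (_ : Utilde B l = fun w => \sum_(k < N) cos (angle k) * B k w).
    exact: (mlin (fun k => cos (angle k))).
  by apply/funext => w; rewrite UtildeE.
have mV : measurable_fun setT (Vtilde B l).
  rewrite (_ : Vtilde B l = fun w => \sum_(k < N) - sin (angle k) * B k w).
    exact: (mlin (fun k => - sin (angle k))).
  by apply/funext => w; rewrite VtildeE.
have mX : measurable_fun setT (absX B l).
  rewrite (_ : absX B l = Num.sqrt \o
      (fun w => Utilde B l w ^+ 2 + Vtilde B l w ^+ 2)).
    apply: measurableT_comp.
      by apply: continuous_measurable_fun; exact: sqrt_continuous.
    by apply: measurable_funD; exact: measurable_funX.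
  by apply/funext => w; rewrite absXE.
pose root k : R[i]%C := (cos (angle k) +i* (- sin (angle k)))%C.
pose f b := ComplexField.Normc.normc (\sum_(k < N) root k * (nth false b k)%:R).
pose mu := bernoulli_mean (m%:R / N%:R) N f.
have absXf b w : size b = N -> outcome_event B b w -> absX B l w = f b.
  by move=> _ bw; exact: absX_outcome.
(* The expectation is the real number [mu], so the event can be stated without extended reals. *)
have -> : ('E_P[absX B l])%E = mu%:E.
  apply: (expectation_bernoulli_family hind hB1 hB0) => //.
  by move=> w; rewrite absXE sqrtr_ge0.
rewrite (_ : [set w | _] = [set w | (t <= `|absX B l w - mu|)%R]); last first.
  by apply/seteqP; split => w; rewrite /= lee_fin.
rewrite (@probability_bernoulli_family _ _ _ _ _ B _ hind hB1 hB0
  (fun w => t <= `|absX B l w - mu|)%R (fun b => t <= `|f b - mu|)%R); last 2 first.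
- by apply: measurable_tail; apply: measurable_funB => //; exact: measurable_cst.
- by move=> b w bN bw; rewrite (absXf b w).
rewrite lee_fin.
have V : \sum_(k < N) (1 : R) ^+ 2 = N%:R.
  by under eq_bigr do rewrite expr1n; rewrite sumr_const card_ord.
(* [N] is read as the sum of [N] squares of 1, the modulus of each root being 1. *)
rewrite -[in leRHS]V; apply: (mcdiarmid (c := fun=> 1)) => //; last by rewrite V.
move=> b1 b2 b12; rewrite -(@normc_root R N l (size b1)).
exact: (@bounded_differences_normc R N root).
Qed.
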